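(* Let $(M,d)$ be a compact metric space and $f\colon M\to M$ a homeomorphism. If $f$ is expansive then $f$ has an expansive shadowing envelope; that is, there exist a compact metric space $(M',d')$ and an expansive homeomorphism $f'\colon M'\to M'$ such that $(M',f')$ is a shadowing envelope of $(M,f)$.
   Context: A homeomorphism $g$ of a compact metric space $(Y,\rho)$ is expansive if there is $\alpha>0$ such that: $x,y\in Y$ and $\rho(g^nx,g^ny)\le\alpha$ for all $n\in\mathbb Z$ implies $x=y$. For $\delta>0$, a bi-sequence $(x_n)_{n\in\mathbb Z}$ in $M$ is a $\delta$-pseudo orbit of $f$ if $d(fx_n,x_{n+1})<\delta$ for all $n\in\mathbb Z$. Let $(M',d')$ be a compact metric space and $f'\colon M'\to M'$ a homeomorphism. $(M',f')$ is a shadowing envelope of $(M,f)$ if there exists an embedding (continuous injective map) $\mu\colon M\to M'$ such that $f'\circ\mu=\mu\circ f$, and for every $\varepsilon>0$ there exists $\delta>0$ such that for every $\delta$-pseudo orbit $(x_n)_{n\in\mathbb Z}$ of $f$ there exists $x'\in M'$ such that $d'\bigl(f'^n x',\mu(x_n)\bigr)<\varepsilon$ for all $n\in\mathbb Z$. *)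

(* Defs.v *)
From HB Require Import structures.
From mathcomp Require Import all_boot all_order all_algebra.
From mathcomp Require Import classical_sets reals topology.

Set Implicit Arguments.
Unset Strict Implicit.
Unset Printing Implicit Defensive.

Import Order.TTheory GRing.Theory Num.Theory.

Local Open Scope classical_set_scope.
Local Open Scope ring_scope.

(* Self-homeomorphisms carry their inverse, so that negative iterates are
   available without choice. *)
Record homeo (T : topologicalType) := Homeo {
  homeo_fun :> T -> T;
  homeo_inv : T -> T;
  homeo_funK : cancel homeo_fun homeo_inv;
  homeo_invK : cancel homeo_inv homeo_fun;
  homeo_fun_continuous : continuous homeo_fun;
  homeo_inv_continuous : continuous homeo_inv }.

(* [Negz k] is the integer - k.+1. *)
Definition iterz (T : topologicalType) (f : homeo T) (n : int) : T -> T :=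
  match n with
  | Posz k => iter k f
  | Negz k => iter k.+1 (homeo_inv f)
  end.

Definition expansive (R : realType) (Y : metricType R) (g : homeo Y) : Prop :=
  exists2 alpha : R, 0 < alpha &
    forall x y : Y,
      (forall n : int, mdist (iterz g n x) (iterz g n y) <= alpha) -> x = y.

Definition pseudo_orbit (R : realType) (M : metricType R) (f : homeo M)
    (delta : R) (x : int -> M) : Prop :=
  forall n : int, mdist (f (x n)) (x (n + 1)) < delta.

(* Compactness of [M] and [M'] is not part of this definition: it is assumed
   of [M] and has to be asserted of [M'] separately. *)
Definition shadowing_envelope (R : realType) (M M' : metricType R)
    (f : homeo M) (f' : homeo M') : Prop :=
  exists mu : M -> M',
    [/\ continuous mu, injective mu, f' \o mu =1 mu \o f &
      forall eps : R, 0 < eps ->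
        exists2 delta : R, 0 < delta &
          forall x : int -> M, pseudo_orbit f delta x ->
            exists x' : M',
              forall n : int, mdist (iterz f' n x') (mu (x n)) < eps].

(* Main.v *)
From HB Require Import structures.
Require Import Defs.
From mathcomp Require Import all_boot all_order all_algebra.
From mathcomp Require Import boolp classical_sets reals topology.
From mathcomp Require Import lra zify.

(* Let c be an expansivity constant of f and alpha = c / 3. By compactness there
   are m and delta such that two delta-pseudo orbits that are alpha-close on a
   window of radius m are alpha/2-close at its centre. Hence, on delta-pseudo
   orbits, being alpha-close at all times is transitive; the envelope M' is the
   quotient by this relation, with the map induced by the shift. The
   entourages "alpha-close on [-N(m+1), N(m+1)]" satisfy
   V_(N+1) o V_(N+1) <= V_N, hence are a base of a metrizable uniformity on M',
   and the shift is expansive for it by construction. A point u of M is sent to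
   the class of its orbit, and a pseudo orbit is shadowed by its own class. *)

Set Implicit Arguments.
Unset Strict Implicit.
Unset Printing Implicit Defensive.

Import Order.TTheory GRing.Theory Num.Theory.

Local Open Scope classical_set_scope.
Local Open Scope ring_scope.

(** * Metrization from a countable base of entourages *)

Section PseudometricBase.
Context (T : choiceType) (V : nat -> set (T * T)).
Hypothesis V_refl : forall n x, V n (x, x).
Hypothesis V_sym : forall n x y, V n (x, y) -> V n (y, x).
Hypothesis V_trans : forall n x y z,
  V n.+1 (x, y) -> V n.+1 (y, z) -> V n (x, z).

Let VS n : V n.+1 `<=` V n.
Proof. by move=> [x y] Vxy; apply: V_trans (V_refl _ _). Qed.

Let V_le m n : (m <= n)%N -> V n `<=` V m.
Proof.
elim: n => [|n IHn]; first by rewrite leqn0 => /eqP->.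
by rewrite leq_eqVlt ltnS => /predU1P[->//|/IHn]; apply: subset_trans.
Qed.

Let ent : set_system (T * T) := filter_from [set: nat] V.

Let ent_filter : Filter ent.
Proof.
apply: filter_from_filter; first by exists 0%N.
move=> i j _ _; exists (maxn i j) => // p Vp.
by split; apply: V_le Vp; rewrite ?leq_maxl ?leq_maxr.
Qed.

Let ent_diag A : ent A -> diagonal `<=` A.
Proof. move=> [n _ VA] [x y] /diagonalP xy; by apply: VA; rewrite xy. Qed.

Let ent_inv A : ent A -> ent (A^-1)%relation.
Proof. by move=> [n _ VA]; exists n => // -[x y] /V_sym/VA. Qed.

Let ent_split A : ent A -> exists2 B, ent B & (B \; B)%relation `<=` A.
Proof.
move=> [n _ VA]; exists (V n.+1); first by exists n.+1.
by move=> [x z] [y] /= Vxy Vyz; apply: VA; exact: V_trans Vxy Vyz.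
Qed.

(** A copy of [T], so that the uniformity generated by [V] lives on a carrier of its own. *)
Let based_uniform : Type := T.

HB.instance Definition _ := Choice.on based_uniform.
HB.instance Definition _ := @isUniform.Build based_uniform
  ent ent_filter ent_diag ent_inv ent_split.

(** A uniformity with a countable base is pseudometrizable. The pseudometric comes as a family of
    balls, and the distance is recovered as the infimum of the radii of balls around [x] containing
    [y]. *)
Lemma pseudometric_of_base (R : realType) : exists d : T -> T -> R,
  [/\ (forall x, d x x = 0),
      (forall x y, d x y = d y x),
      (forall y x z, d x z <= d x y + d y z) &
      (forall n, exists2 e, 0 < e & forall x y, d x y < e -> V n (x, y)) /\
      (forall e, 0 < e -> exists n, forall x y, V n (x, y) -> d x y < e)].
Proof.
pose U : uniformType := based_uniform.
have cntU : countable_uniformity U.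
  apply/countable_uniformityP; exists V => [A [n _]|n]; first by exists n.
  by exists n.
pose X : pseudoMetricType R := countable_uniform cntU.
pose B (x y : T) : set R := [set e | 0 < e /\ @ball R X x e y].
(* Any two points lie within radius 2 of each other here, so the infimum is over a nonempty set. *)
have B2 x y : B x y !=set0.
  by exists 2; split=> //; exact: countable_uniform.countable_uniform_bounded.
have Blb x y : lbound (B x y) 0 by move=> e [/ltW].
have Bhlb x y : has_lbound (B x y) by exists 0.
have Binf x y : has_inf (B x y) by split.
exists (fun x y => inf (B x y)).
have d_ge0 x y : 0 <= inf (B x y) by exact: lb_le_inf.
split=> //.
- move=> x; apply/eqP; rewrite eq_le d_ge0 andbT; apply/ler_addgt0Pl => e e0.
  by rewrite addr0; apply: ge_inf => //; split=> //; exact: ballxx.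
- move=> x y; congr inf; apply/seteqP.
  by split=> e [e0 /ball_sym Be].
- move=> y x z; apply/ler_addgt0Pl => e e0.
  have [e1 [e10 B1] le1] := inf_adherent (divr_gt0 e0 (ltr0n _ 2)) (Binf x y).
  have [e2 [e20 B3] le2] := inf_adherent (divr_gt0 e0 (ltr0n _ 2)) (Binf y z).
  apply: (@le_trans _ _ (e1 + e2)); last lra.
  by apply: ge_inf => //; split; [rewrite addr_gt0|exact: ball_triangle B1 B3].
(* The balls and the sets [V n] generate the same entourages; both comparisons are read off from
   this equality. *)
- have entE : ent = entourage_ (@ball R X).
    by rewrite entourage_ballE.
  split=> [n|e e0].
    have : ent (V n) by exists n.
    rewrite entE => -[e /= e0 eV]; exists e => // x y.
    case/(inf_lt (B2 x y)) => e' [e'0 Be'] /ltW e'e.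
    by apply: (eV (x, y)); exact: le_ball e'e _ Be'.
  have : ent [set xy | @ball R X xy.1 (e / 2) xy.2].
    by rewrite entE; exists (e / 2) => //=; rewrite divr_gt0.
  move=> [n _ Vn]; exists n => x y /Vn /= Bxy.
  apply: (@le_lt_trans _ _ (e / 2)); last lra.
  by apply: ge_inf => //; split=> //; rewrite divr_gt0.
Qed.

End PseudometricBase.

Section MetricOfDistance.
Context (R : realType) (T : choiceType) (d : T -> T -> R).
Hypothesis d_xx : forall x, d x x = 0.
Hypothesis d_eq0 : forall x y, d x y = 0 -> x = y.
Hypothesis d_sym : forall x y, d x y = d y x.
Hypothesis d_triangle : forall y x z, d x z <= d x y + d y z.

Let carrier : Type := T.

HB.instance Definition _ := Choice.on carrier.
HB.instance Definition _ := @isMetric.Build R carrier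
  d d_xx d_eq0 d_sym d_triangle.

Lemma metric_of_distance :
  exists (X : metricType R) (h : T -> X) (g : X -> T),
    [/\ cancel h g, cancel g h & forall p q, mdist p q = d (g p) (g q)].
Proof. by exists carrier, id, id. Qed.

End MetricOfDistance.

(** Points at distance zero lie in every [V n], so separation turns the pseudometric into a
    metric. *)
Lemma metric_of_base (R : realType) (T : choiceType) (V : nat -> set (T * T)) :
  (forall n x, V n (x, x)) ->
  (forall n x y, V n (x, y) -> V n (y, x)) ->
  (forall n x y z, V n.+1 (x, y) -> V n.+1 (y, z) -> V n (x, z)) ->
  (forall x y, (forall n, V n (x, y)) -> x = y) ->
  exists (X : metricType R) (h : T -> X) (g : X -> T),
    [/\ cancel h g, cancel g h,
      (forall n, exists2 e, 0 < e &
        forall p q, mdist p q < e -> V n (g p, g q)) &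
      (forall e, 0 < e -> exists n,
        forall p q, V n (g p, g q) -> mdist p q < e)].
Proof.
move=> V_refl V_sym V_trans V_sep.
have [d [d_xx d_sym d_tri [dV Vd]]] :=
  pseudometric_of_base V_refl V_sym V_trans R.
have d_eq0 x y : d x y = 0 -> x = y.
  by move=> dxy; apply: V_sep => n; have [e e0] := dV n; apply; rewrite dxy.
have [X [h [g [hK gK dE]]]] := metric_of_distance d_xx d_eq0 d_sym d_tri.
exists X, h, g; split=> // [n|e e0].
  by have [e e0 eV] := dV n; exists e => // p q; rewrite dE => /eV.
by have [n nV] := Vd e e0; exists n => p q /nV; rewrite dE.
Qed.

(** * Pseudo orbits of expansive homeomorphisms *)

Section Iterates.
Context (T : topologicalType) (f : homeo T).

Lemma iterzS n x : iterz f (n + 1) x = f (iterz f n x).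
Proof.
case: n => [k|[|k]] /=.
- by rewrite addn1.
- by rewrite homeo_invK.
- by rewrite homeo_invK subn1.
Qed.

Lemma iterzB1 n x : iterz f (n - 1) x = homeo_inv f (iterz f n x).
Proof. by rewrite -{2}(subrK 1 n) iterzS homeo_funK. Qed.

Lemma iterzD m n x : iterz f (m + n) x = iterz f m (iterz f n x).
Proof.
elim: m => [|m IHm|m IHm]; first by rewrite add0r.
  by rewrite -addn1 PoszD addrAC !iterzS IHm.
by rewrite -addn1 PoszD opprD addrAC !iterzB1 IHm.
Qed.

Lemma iterz_continuous n : continuous (iterz f n).
Proof.
have iter_cont (g : T -> T) k : continuous g -> continuous (iter k g).
  move=> cg; elim: k => [|k IHk] x; first exact: cvg_id.
  exact: (continuous_comp (IHk x) (cg _)).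
case: n => k; apply: iter_cont.
  exact: homeo_fun_continuous.
exact: homeo_inv_continuous.
Qed.

End Iterates.

Lemma mdist_nbhs (R : realType) (X : metricType R) (x : X) e :
  0 < e -> nbhs x [set y | mdist x y < e].
Proof. by move=> e0; rewrite -ballEmdist; exact: nbhsx_ballx. Qed.

Lemma mdist_continuousP (R : realType) (X Y : metricType R) (g : X -> Y) :
  continuous g <-> forall x e, 0 < e ->
    exists2 r, 0 < r & forall y, mdist x y < r -> mdist (g x) (g y) < e.
Proof.
split=> [cg x e e0|cg x A].
  have /cg /= : nbhs (g x) [set y | mdist (g x) y < e] by exact: mdist_nbhs.
  rewrite nbhs_simpl /= -nbhs_ballE => -[r /= r0 rA]; exists r => // y xy.
  by apply: rA; rewrite ballEmdist.
rewrite nbhs_simpl -nbhs_ballE => -[e /= e0 eA].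
have [r r0 rg] := cg x e e0.
rewrite /= -nbhs_ballE; exists r => //= y.
by rewrite ballEmdist => /rg gxy; apply: eA; rewrite ballEmdist.
Qed.

(** * Cluster points and uniform continuity *)

Section CompactMetric.
Context (R : realType) (M : metricType R).
Hypothesis cM : compact [set: M].

(** Compactness of the product gives both approximations at one common, arbitrarily late index; this
    replaces extracting a subsequence. *)
Lemma compact_cluster_pair (u v : nat -> M) : exists x y, forall N e, 0 < e ->
  exists2 n, (N <= n)%N & mdist x (u n) < e /\ mdist y (v n) < e.
Proof.
have := compact_setX cM cM; rewrite setXTT => cMM.
have [[x y] [_ xy]] :
    [set: M * M] `&` cluster ((fun n => (u n, v n)) @ \oo) !=set0.
  by apply: cMM; exact: filterT.
exists x, y => N e e0.
have /xy : ((fun n => (u n, v n)) @ \oo)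
    [set (u n, v n) | n in [set n | (N <= n)%N]].
  by exists N => // n Nn; exists n.
case/(_ ([set y | mdist x y < e] `*` [set z | mdist y z < e])).
  by exists ([set y | mdist x y < e], [set z | mdist y z < e]) => //=;
    split; exact: mdist_nbhs.
by move=> _ [[n Nn <-]] [/= xu yv]; exists n.
Qed.

Lemma compact_unif_continuous (Y : metricType R) (g : M -> Y) :
  continuous g -> forall e, 0 < e ->
  exists2 r, 0 < r & forall x y, mdist x y < r -> mdist (g x) (g y) < e.
Proof.
move=> /mdist_continuousP cg e e0; apply: contrapT => H.
have /choice[u Hu] n : exists xy : M * M,
    mdist xy.1 xy.2 < n.+1%:R^-1 /\ e <= mdist (g xy.1) (g xy.2).
  apply: contrapT => Hn; apply: H; exists n.+1%:R^-1; first by rewrite invr_gt0.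
  move=> x y xy; rewrite ltNge; apply/negP => gxy; apply: Hn.
  by exists (x, y).
have [x [x' xP]] := compact_cluster_pair (fst \o u) (snd \o u).
have [r r0 rg] := cg x (e / 2) (divr_gt0 e0 (ltr0n _ 2)).
have r20 : 0 < r / 2 by rewrite divr_gt0.
(* So late an index gives [n.+1%:R^-1 < r / 2], which puts the second component within [r] of [x]
   too. *)
have [n nr [/= xun _]] := xP (Num.truncn (r / 2)^-1) _ r20.
have [un gun] := Hu n.
have nr2 : n.+1%:R^-1 < r / 2.
  rewrite -[ltRHS]invrK ltf_pV2 ?posrE ?invr_gt0//.
  by rewrite (lt_le_trans (truncnS_gt _))// ler_nat.
have := metric_triangle x (u n).1 (u n).2.
have := metric_triangle (g (u n).1) (g x) (g (u n).2).
rewrite (metric_sym (g (u n).1) (g x)) => gt xt.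
have xu1 : mdist x (u n).1 < r by lra.
have xu2 : mdist x (u n).2 < r by have := lt_trans un nr2; lra.
have := rg _ xu1; have := rg _ xu2; lra.
Qed.

End CompactMetric.

(** * Comparison of orbits and pseudo orbits on finite windows *)

Section Tracking.
Context (R : realType) (M : metricType R) (f : homeo M).
Hypothesis cM : compact [set: M].

Lemma iterz_equicontinuous N e : 0 < e -> exists2 r, 0 < r &
  forall x y, mdist x y < r ->
    forall n : int, (`|n| <= N)%N -> mdist (iterz f n x) (iterz f n y) < e.
Proof.
move=> e0.
have H n := compact_unif_continuous cM (@iterz_continuous _ f n) e0.
elim: N => [|N [r r0 IHN]].
  have [r r0 rf] := H 0; exists r => // x y /rf xy n.
  by rewrite leqn0 absz_eq0 => /eqP ->.
have [r1 r10 H1] := H N.+1%:Z; have [r2 r20 H2] := H (- N.+1%:Z).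
exists (Num.min r (Num.min r1 r2)); first by rewrite !lt_min r0 r10 r20.
move=> x y; rewrite !lt_min => /and3P[xr x1 x2] n.
rewrite leq_eqVlt ltnS => /predU1P[|]; last exact: IHN.
move=> nN; have [->|->] : n = N.+1%:Z \/ n = - N.+1%:Z by lia.
  exact: H1.
exact: H2.
Qed.

(** Otherwise, for each [m], some pair is [c]-close on the window [m] yet [e] apart. At a cluster
    pair, closeness passes to the limit at every time, so expansivity makes the two limits equal,
    against the separation [e]. *)
Lemma expansive_window (c : R) :
  (forall x y : M,
    (forall n : int, mdist (iterz f n x) (iterz f n y) <= c) -> x = y) ->
  forall e, 0 < e -> exists m : nat, forall x y : M,
    (forall n : int, (`|n| <= m)%N -> mdist (iterz f n x) (iterz f n y) <= c) ->
    mdist x y < e.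
Proof.
move=> fc e e0; apply: contrapT => H.
have /choice[u Hu] m : exists xy : M * M,
    (forall n : int, (`|n| <= m)%N ->
      mdist (iterz f n xy.1) (iterz f n xy.2) <= c) /\ e <= mdist xy.1 xy.2.
  apply: contrapT => Hm; apply: H; exists m => x y xy.
  by rewrite ltNge; apply/negP => exy; apply: Hm; exists (x, y).
have [x [y xyP]] := compact_cluster_pair cM (fst \o u) (snd \o u).
suff xy : x = y.
  have [n _ [/=]] := xyP 0%N _ (divr_gt0 e0 (ltr0n _ 2)).
  have [_] := Hu n; have := metric_triangle (u n).1 x (u n).2.
  rewrite -xy (metric_sym _ x); lra.
apply: fc => n; rewrite leNgt; apply/negP => cxy.
(* Half of the excess over [c]: replacing both points by approximants costs less than the whole
   excess. *)
pose eta := (mdist (iterz f n x) (iterz f n y) - c) / 2.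
have eta0 : 0 < eta by rewrite divr_gt0// subr_gt0.
have [r r0 rf] := iterz_equicontinuous `|n| eta0.
have [k nk [/= /rf/(_ n (leqnn _)) xu /rf/(_ n (leqnn _)) yv]] :=
  xyP `|n|%N _ r0.
have [/(_ n nk) uv _] := Hu k.
have := metric_triangle (iterz f n x) (iterz f n (u k).1) (iterz f n y).
have := metric_triangle (iterz f n (u k).1) (iterz f n (u k).2) (iterz f n y).
rewrite (metric_sym (iterz f n (u k).2)); move: xu yv uv; rewrite /eta; lra.
Qed.

Lemma pseudo_orbit_forward (m : nat) e : 0 < e -> exists2 delta, 0 < delta &
  forall x : int -> M, pseudo_orbit f delta x ->
    forall (n : int) (k : nat), (k <= m)%N ->
      mdist (iter k f (x n)) (x (n + k)) < e.
Proof.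
elim: m e => [|m IHm] e e0.
  exists 1 => // x _ n k; rewrite leqn0 => /eqP -> /=.
  by rewrite addr0 mdistxx.
have e20 : 0 < e / 2 by rewrite divr_gt0.
have [r r0 rf] := compact_unif_continuous cM (@homeo_fun_continuous _ f) e20.
(* The bound [r] feeds uniform continuity in the last step; [e] settles the times [k <= m]. *)
have [d d0 dH] := IHm (Num.min r e) ltac:(by rewrite lt_min r0).
exists (Num.min d (e / 2)); first by rewrite lt_min d0.
move=> x xP n k.
have {}dH : forall (n : int) (k : nat), (k <= m)%N ->
    mdist (iter k f (x n)) (x (n + k)) < Num.min r e.
  by apply: dH => i; have := xP i; rewrite lt_min => /andP[].
rewrite leq_eqVlt ltnS => /predU1P[->{k}|/(dH n)]; last first.
  by rewrite lt_min => /andP[].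
have := dH n m (leqnn m); rewrite lt_min => /andP[/rf /= fr _].
have := xP (n + m); rewrite lt_min => /andP[_].
rewrite (_ : n + m + 1 = n + m.+1); last lia.
have := metric_triangle (f (iter m f (x n))) (f (x (n + m))) (x (n + m.+1)).
lra.
Qed.

(** The tracing orbit starts at the left end of the window and runs forward for at most [N + N]
    steps, so forward tracking suffices; [u] is its point at the centre. *)
Lemma pseudo_orbit_window (N : nat) e : 0 < e -> exists2 delta, 0 < delta &
  forall x : int -> M, pseudo_orbit f delta x -> forall n : int,
    exists u : M, forall k : int, (`|k| <= N)%N ->
      mdist (iterz f k u) (x (n + k)) < e.
Proof.
move=> /(pseudo_orbit_forward (N + N)) [d d0 H]; exists d => // x /H {}H n.
exists (iterz f N (x (n - N%:Z))) => k kN; rewrite -iterzD.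
have -> : k + N = Posz `|(k + N%:Z)%R|%N by lia.
have := H (n - N%:Z) `|(k + N%:Z)%R|%N.
rewrite (_ : n - N%:Z + `|(k + N%:Z)%R|%N = n + k); last lia.
by apply; lia.
Qed.

(** The tracing point [u] is close to [x n] by the case [k = 0], and equicontinuity allows replacing
    it by [x n]. *)
Lemma pseudo_orbit_near_orbit (N : nat) e : 0 < e -> exists2 delta, 0 < delta &
  forall x : int -> M, pseudo_orbit f delta x -> forall n k : int,
    (`|k| <= N)%N -> mdist (iterz f k (x n)) (x (n + k)) < e.
Proof.
move=> e0; have e20 : 0 < e / 2 by rewrite divr_gt0.
have [r r0 rf] := iterz_equicontinuous N e20.
have [|d d0 dH] := @pseudo_orbit_window N (Num.min r (e / 2)).
  by rewrite lt_min r0.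
exists d => // x /dH xP n k kN; have [u uP] := xP n.
have := uP 0 isT; rewrite addr0 lt_min => /andP[/rf/(_ k kN) + _].
have := uP k kN; rewrite lt_min => /andP[_].
have := metric_triangle (iterz f k (x n)) (iterz f k u) (x (n + k)).
rewrite (metric_sym _ (iterz f k u)); lra.
Qed.

Lemma expansive_pseudo_orbit (c : R) : 0 < c ->
  (forall x y : M,
    (forall n : int, mdist (iterz f n x) (iterz f n y) <= c) -> x = y) ->
  exists (m : nat) (delta : R), 0 < delta /\
    forall x y : int -> M, pseudo_orbit f delta x -> pseudo_orbit f delta y ->
    forall n : int,
      (forall k : int, (`|k| <= m)%N ->
        mdist (x (n + k)) (y (n + k)) <= c / 3) ->
      mdist (x n) (y n) <= c / 6.
Proof.
(* Tracing orbits of [u] and [v] are within [c / 3 + 2 * (c / 18) <= c] on the window, hence [u] and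
   [v] are [c / 18]-close; three such errors add up to [c / 6] at the centre. *)
move=> c0 fc; have e0 : 0 < c / 18 by rewrite divr_gt0.
have [m mP] := expansive_window fc e0.
have [d d0 dP] := pseudo_orbit_window m e0.
exists m, d; split=> // x y /dP xP /dP yP n xy.
have [[u uP] [v vP]] := (xP n, yP n).
have : mdist u v < c / 18.
  apply: mP => k km; have := uP k km; have := vP k km; have := xy k km.
  have := metric_triangle (iterz f k u) (x (n + k)) (iterz f k v).
  have := metric_triangle (x (n + k)) (y (n + k)) (iterz f k v).
  rewrite (metric_sym (y (n + k))); lra.
have := uP 0 isT; have := vP 0 isT; rewrite !addr0 /=.
have := metric_triangle (x n) u (y n); have := metric_triangle u v (y n).
rewrite (metric_sym (x n) u); lra.
Qed.

End Tracking.

(** * The space of classes of pseudo orbits *)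

Section PseudoOrbitClasses.
Context (R : realType) (M : metricType R) (f : homeo M).
Context (m : nat) (alpha delta : R).
Hypothesis alpha_gt0 : 0 < alpha.
Hypothesis delta_gt0 : 0 < delta.
Hypothesis halving : forall x y : int -> M,
  pseudo_orbit f delta x -> pseudo_orbit f delta y -> forall n : int,
  (forall k : int, (`|k| <= m)%N -> mdist (x (n + k)) (y (n + k)) <= alpha) ->
  mdist (x n) (y n) <= alpha / 2.

(* A non-strict bound, so that these sequences form a closed set. *)
Definition weak_orbit (x : int -> M) :=
  forall n, mdist (f (x n)) (x (n + 1)) <= delta / 2.

Definition seq_close (x y : int -> M) := forall n, mdist (x n) (y n) <= alpha.

(** Each level widens the window by [m.+1]: [m] for one use of halving, and at least 1 so that a
    unit shift costs one level and the windows exhaust the integers even if [m = 0]. *)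
Definition seq_close_on (N : nat) (x y : int -> M) :=
  forall n : int, (`|n| <= N * m.+1)%N -> mdist (x n) (y n) <= alpha.

Definition seq_shift (j : int) (x : int -> M) : int -> M := fun n => x (j + n).

Lemma weak_orbit_halving x y n : weak_orbit x -> weak_orbit y ->
  (forall k : int, (`|k| <= m)%N -> mdist (x (n + k)) (y (n + k)) <= alpha) ->
  mdist (x n) (y n) <= alpha / 2.
Proof.
move=> sx sy; apply: halving => i.
- by have := sx i; move: delta_gt0; lra.
- by have := sy i; move: delta_gt0; lra.
Qed.

Lemma weak_orbit_shift j x : weak_orbit x -> weak_orbit (seq_shift j x).
Proof. by move=> sx n; rewrite /seq_shift addrA; exact: sx. Qed.

Lemma weak_orbit_iterz u : weak_orbit (iterz f ^~ u).
Proof. by move=> n; rewrite iterzS mdistxx divr_ge0// ltW. Qed.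

Lemma seq_shiftD i j x : seq_shift i (seq_shift j x) = seq_shift (i + j) x.
Proof. by apply/funext => n; rewrite /seq_shift addrCA addrA. Qed.

Lemma seq_shift0 x : seq_shift 0 x = x.
Proof. by apply/funext => n; rewrite /seq_shift add0r. Qed.

Lemma seq_shift_iterz j u :
  seq_shift j (iterz f ^~ u) = iterz f ^~ (iterz f j u).
Proof. by apply/funext => n; rewrite /seq_shift addrC iterzD. Qed.

Lemma seq_close_refl x : seq_close x x.
Proof. by move=> n; rewrite mdistxx ltW. Qed.

#[local] Hint Resolve weak_orbit_shift weak_orbit_iterz seq_close_refl : core.

Lemma seq_close_sym x y : seq_close x y -> seq_close y x.
Proof. by move=> xy n; rewrite metric_sym. Qed.

Lemma seq_close_shift j x y :
  seq_close x y -> seq_close (seq_shift j x) (seq_shift j y).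
Proof. by move=> xy n; exact: xy. Qed.

Lemma seq_close_onW N x y : seq_close x y -> seq_close_on N x y.
Proof. by move=> xy n _; exact: xy. Qed.

Lemma closeP x y : seq_close x y <-> forall N, seq_close_on N x y.
Proof.
split=> [xy N|xy n]; first exact: seq_close_onW.
by apply: (xy `|n|%N); rewrite leq_pmulr.
Qed.

Lemma seq_close_on_sym N x y : seq_close_on N x y -> seq_close_on N y x.
Proof. by move=> xy n /xy; rewrite metric_sym. Qed.

(** Each time of the smaller window has its [m] neighbours on either side in the larger one, so
    halving improves both bounds to [alpha / 2]. *)
Lemma seq_close_on_trans N x y z :
  weak_orbit x -> weak_orbit y -> weak_orbit z ->
  seq_close_on N.+1 x y -> seq_close_on N.+1 y z -> seq_close_on N x z.
Proof.
move=> sx sy sz xy yz n nN.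
have bound k : (`|k| <= m)%N -> (`|(n + k)%R| <= N.+1 * m.+1)%N.
  by move=> km; rewrite mulSn; lia.
have hxy : mdist (x n) (y n) <= alpha / 2.
  by apply: weak_orbit_halving => // k /bound; exact: xy.
have hyz : mdist (y n) (z n) <= alpha / 2.
  by apply: weak_orbit_halving => // k /bound; exact: yz.
by have := metric_triangle (x n) (y n) (z n); lra.
Qed.

Lemma seq_close_trans x y z : weak_orbit x -> weak_orbit y -> weak_orbit z ->
  seq_close x y -> seq_close y z -> seq_close x z.
Proof.
move=> sx sy sz /closeP xy /closeP yz; apply/closeP => N.
exact: (seq_close_on_trans sx sy sz).
Qed.

(** Changing both representatives uses transitivity twice, hence the two levels. *)
Lemma seq_close_on_congr N x x' y y' :
  weak_orbit x -> weak_orbit x' -> weak_orbit y -> weak_orbit y' ->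
  seq_close x x' -> seq_close y y' ->
  seq_close_on N.+2 x' y' -> seq_close_on N x y.
Proof.
move=> sx sx' sy sy' xx' yy' x'y'.
apply: (@seq_close_on_trans _ _ y') => //;
  last exact/seq_close_onW/seq_close_sym.
by apply: (@seq_close_on_trans _ _ x') => //; exact: seq_close_onW.
Qed.

Lemma seq_close_on_shift N j x y : (`|j| <= 1)%N ->
  seq_close_on N.+1 x y -> seq_close_on N (seq_shift j x) (seq_shift j y).
Proof. by move=> j1 xy n nN; apply: xy; rewrite mulSn; lia. Qed.

(** The quotient is realized as the subtype of canonical representatives, the fixed points of a
    choice [rep] that is constant on classes; [w] returns the representative. *)
Lemma pseudo_orbit_classes : exists (X : metricType R) (w : X -> int -> M),
  [/\ (forall p, weak_orbit (w p)),
    (forall p q, seq_close (w p) (w q) -> p = q),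
    (forall x, weak_orbit x -> exists p, seq_close x (w p)) &
    (forall N, exists2 e, 0 < e &
      forall p q, mdist p q < e -> seq_close_on N (w p) (w q)) /\
    (forall e, 0 < e -> exists N,
      forall p q, seq_close_on N (w p) (w q) -> mdist p q < e)].
Proof.
pose P x : pred (int -> M) := fun z => `[< weak_orbit z /\ seq_close x z >].
pose rep (x : int -> M) := choose (P x) x.
have repP x : weak_orbit x -> weak_orbit (rep x) /\ seq_close x (rep x).
  move=> sx; apply/asboolP.
  have xx : P x x by apply/asboolP.
  exact: (@chooseP _ (P x) x xx).
have rep_eq x y :
    weak_orbit x -> weak_orbit y -> seq_close x y -> rep x = rep y.
  move=> sx sy xy; rewrite /rep.
  have -> : P x = P y.
    apply/funext => z; apply: asbool_equiv_eq; split=> -[sz] h; split=> //.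
      exact: (seq_close_trans sy sx sz (seq_close_sym xy) h).
    exact: (seq_close_trans sx sy sz xy h).
  (* The defaults [x] and [y] differ, but both satisfy the predicate, so the choices agree. *)
  apply: choose_id; apply/asboolP; split=> //; exact: seq_close_sym.
pose T : choiceType := {x : int -> M | `[< weak_orbit x /\ rep x = x >]}.
have TP (p : T) : weak_orbit (val p) /\ rep (val p) = val p.
  by apply/asboolP; exact: valP p.
pose V N : set (T * T) := [set pq | seq_close_on N (val pq.1) (val pq.2)].
have [||||X [h [g [hK gK XV VX]]]] := @metric_of_base R T V.
- by move=> n x; exact: seq_close_onW.
- by move=> n x y; exact: seq_close_on_sym.
- move=> n x y z; apply: seq_close_on_trans.
  + by have [] := TP x.
  + by have [] := TP y.
  + by have [] := TP z.
- move=> p q /closeP pq; apply: val_inj.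
  have [sp <-] := TP p; have [sq <-] := TP q.
  exact: rep_eq.
exists X, (fun p => val (g p)); split=> // [p|p q pq|x sx].
- by have [] := TP (g p).
- apply: (can_inj gK); apply: val_inj.
  have [sp <-] := TP (g p); have [sq <-] := TP (g q).
  exact: rep_eq.
- have [srx xrx] := repP x sx.
  have rT : `[< weak_orbit (rep x) /\ rep (rep x) = rep x >].
    by apply/asboolP; split=> //; apply: rep_eq => //; exact: seq_close_sym.
  by exists (h (exist _ (rep x) rT)); rewrite hK.
Qed.

Lemma prod_nbhs (x : prod_topology (fun _ : int => M)) (K : nat) r : 0 < r ->
  nbhs x [set y | forall n : int, (`|n| <= K)%N -> mdist (x n) (y n) < r].
Proof.
move=> r0; have Fx : Filter (nbhs x) by exact: nbhs_filter.
have coord (n : int) : nbhs x [set y | mdist (x n) (y n) < r].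
  exact: (@proj_continuous int (fun=> M) n x _ (mdist_nbhs (x n) r0)).
elim: K => [|K IHK].
  by apply: filterS (coord 0) => y xy n; rewrite leqn0 absz_eq0 => /eqP->.
apply: filterS (filterI IHK (filterI (coord K.+1%:Z) (coord (- K.+1%:Z)))).
move=> y [xyK [xy1 xy2]] n; rewrite leq_eqVlt ltnS => /predU1P[nK|/xyK//].
by have [->|->] : n = K.+1%:Z \/ n = - K.+1%:Z by lia.
Qed.

(** * Compactness of the quotient, its shift, and the embedding *)

Section Classes.
Context (X : metricType R) (w : X -> int -> M).
Hypothesis w_weak : forall p, weak_orbit (w p).
Hypothesis w_inj : forall p q, seq_close (w p) (w q) -> p = q.
Hypothesis w_surj : forall x, weak_orbit x -> exists p, seq_close x (w p).
Hypothesis mdist_close_on : forall N, exists2 e, 0 < e &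
  forall p q, mdist p q < e -> seq_close_on N (w p) (w q).
Hypothesis seq_close_on_mdist : forall e, 0 < e -> exists N,
  forall p q, seq_close_on N (w p) (w q) -> mdist p q < e.

(** By Tychonoff, the representatives cluster at a sequence [x]. Weak orbits form a closed set, so
    [x] has a class, and that class is a cluster point since closeness on a finite window controls
    the metric. *)
Lemma classes_compact : compact [set: M] -> compact [set: X].
Proof.
move=> cM F PF _.
have PG : ProperFilter (w @ F) by exact: fmap_proper_filter.
have := @tychonoff int (fun=> M) (fun=> [set: M]) (fun=> cM).
case/(_ (w @ F) PG).
  by apply: filterS filterT => p _.
move=> x [_ xF].
have sx : weak_orbit x.
  move=> n; apply/ler_addgt0Pl => e e0.
  have e20 : 0 < e / 2 by rewrite divr_gt0.
  have [r r0 rf] :=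
    (mdist_continuousP f).1 (@homeo_fun_continuous _ f) (x n) _ e20.
  (* [r] controls the error at [f (x n)] and [e / 2] the one at [x (n + 1)]; the window of radius
     [|n| + 1] contains both times. *)
  have re0 : 0 < Num.min r (e / 2) by rewrite lt_min r0.
  have Fw : (w @ F) (range w).
    by apply: (@filterS _ F _ setT) filterT => p _; exists p.
  have [_ [[p _ <-] wp]] := xF _ _ Fw (prod_nbhs x (`|n| + 1) re0).
  have := wp n (leq_addr _ _); rewrite lt_min => /andP[/rf fxw _].
  have /wp : (`|(n + 1)%R| <= `|n| + 1)%N by lia.
  rewrite lt_min => /andP[_ xw1].
  have := w_weak p n.
  have := metric_triangle (f (x n)) (f (w p n)) (x (n + 1)).
  have := metric_triangle (f (w p n)) (w p (n + 1)) (x (n + 1)).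
  rewrite (metric_sym (w p (n + 1))); lra.
have [p xp] := w_surj sx; exists p; split=> // A B FA.
rewrite -nbhs_ballE => -[e /= e0 eB].
have [N NP] := seq_close_on_mdist e0.
have Fw : (w @ F) (w @` A) by apply: (@filterS _ F _ A) FA => q Aq; exists q.
have [_ [[q Aq <-] xq]] := xF _ _ Fw (prod_nbhs x (N.+2 * m.+1) alpha_gt0).
exists q; split=> //; apply: eB; rewrite ballEmdist; apply: NP.
apply: (@seq_close_on_congr _ _ x _ (w q)) => //; first exact: seq_close_sym.
by move=> n /xq /ltW.
Qed.

(** Shifting preserves weak orbits and closeness, and the action laws follow from uniqueness of
    classes. Continuity is stated for unit shifts, which cost a single level. *)
Lemma shift_classes : exists S : int -> X -> X,
  [/\ (forall j p, seq_close (seq_shift j (w p)) (w (S j p))),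
      (forall p, S 0 p = p), (forall i j p, S (i + j) p = S i (S j p)) &
      (forall j, (`|j| <= 1)%N -> continuous (S j))].
Proof.
have /choice[S SP] (jp : int * X) :
    exists q, seq_close (seq_shift jp.1 (w jp.2)) (w q).
  exact/w_surj/weak_orbit_shift/w_weak.
have {}SP j p := SP (j, p); exists (fun j p => S (j, p)); split=> //.
- by move=> p; apply/w_inj/seq_close_sym; have := SP 0 p; rewrite seq_shift0.
- move=> i j p; apply: w_inj.
  apply: (@seq_close_trans _ (seq_shift (i + j) (w p))) => //.
    exact: weak_orbit_shift.
    exact/seq_close_sym/SP.
  rewrite -seq_shiftD.
  apply: (@seq_close_trans _ (seq_shift i (w (S (j, p))))) => //.
  + exact/weak_orbit_shift/weak_orbit_shift.
  + exact: weak_orbit_shift.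
  + exact/seq_close_shift/SP.
  + exact: SP.
- move=> j j1; apply/mdist_continuousP => p e e0.
  have [N NP] := seq_close_on_mdist e0.
  (* One level for the shift and two for the change of representatives. *)
  have [r r0 rP] := mdist_close_on N.+3.
  exists r => // q /rP wpq; apply: NP.
  apply: (@seq_close_on_congr _ _
    (seq_shift j (w p)) _ (seq_shift j (w q))) => //.
  + exact: weak_orbit_shift.
  + exact: weak_orbit_shift.
  + exact/seq_close_sym/SP.
  + exact/seq_close_sym/SP.
  + exact: seq_close_on_shift.
Qed.

Lemma classes_envelope (cM : compact [set: M]) :
  (forall u v : M,
    (forall n, mdist (iterz f n u) (iterz f n v) <= alpha) -> u = v) ->
  exists f' : homeo X, expansive f' /\ shadowing_envelope f f'.
Proof.
move=> f_exp.
have [S [SP S0 SD S_cont]] := shift_classes.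
have SK : cancel (S 1) (S (-1)) by move=> p; rewrite -SD.
have SVK : cancel (S (-1)) (S 1) by move=> p; rewrite -SD.
pose f' := Homeo SK SVK (S_cont 1 isT) (S_cont (-1) isT).
have iterE n p : iterz f' n p = S n p.
  elim: n => [|n IHn|n IHn]; first by rewrite S0.
    by rewrite -addn1 PoszD iterzS IHn addrC SD.
  by rewrite -addn1 PoszD opprD iterzB1 IHn addrC SD.
exists f'; split.
  (* Two levels are lost in changing representatives; level 0 still compares the shifted sequences
     at time 0, that is, the original ones at time [n]. *)
  have [e e0 eP] := mdist_close_on 2.
  exists (e / 2); first by rewrite divr_gt0.
  move=> p q pq; apply: w_inj => n.
  have : seq_close_on 0 (seq_shift n (w p)) (seq_shift n (w q)).
    apply: (@seq_close_on_congr _ _ (w (S n p)) _ (w (S n q))) => //;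
      try exact: weak_orbit_shift.
    by apply: eP; have := pq n; rewrite !iterE; lra.
  by move/(_ 0 isT); rewrite /seq_shift addr0.
have /choice[mu muP] u : exists p, seq_close (iterz f ^~ u) (w p).
  exact: w_surj (weak_orbit_iterz u).
exists mu; split.
- apply/mdist_continuousP => u e e0.
  have [N NP] := seq_close_on_mdist e0.
  have [r r0 rP] := iterz_equicontinuous f cM (N.+2 * m.+1) alpha_gt0.
  exists r => // v uv; apply: NP.
  apply: (@seq_close_on_congr _ _ (iterz f ^~ u) _ (iterz f ^~ v)) => //;
    try exact: seq_close_sym.
  by move=> n nN; apply/ltW/rP.
- move=> u v muuv; apply: f_exp.
  apply: (@seq_close_trans (iterz f ^~ u) (w (mu u)) (iterz f ^~ v)) => //.
  by rewrite muuv; exact: seq_close_sym.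
- move=> u; apply: w_inj => /=.
  apply: (@seq_close_trans _ (seq_shift 1 (w (mu u)))) => //.
  + exact: weak_orbit_shift.
  + exact/seq_close_sym/SP.
  apply: (@seq_close_trans _ (seq_shift 1 (iterz f ^~ u))) => //.
  + exact: weak_orbit_shift.
  + exact: weak_orbit_shift.
  + exact/seq_close_shift/seq_close_sym.
  by rewrite seq_shift_iterz.
(* The class [p] of [x] shadows [x]: [S n p] is the class of [x] shifted by [n], [mu (x n)] that of
   the orbit of [x n], and these two sequences are close on a long window around 0. *)
- move=> e e0; have [N NP] := seq_close_on_mdist e0.
  have [d d0 dP] := pseudo_orbit_near_orbit f cM (N.+2 * m.+1) alpha_gt0.
  exists (Num.min d (delta / 2)); first by rewrite lt_min d0 divr_gt0.
  move=> x xP.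
  have sx : weak_orbit x.
    by move=> n; have := xP n; rewrite lt_min => /andP[_ /ltW].
  have {}dP : forall n k : int, (`|k| <= N.+2 * m.+1)%N ->
      mdist (iterz f k (x n)) (x (n + k)) < alpha.
    by apply: dP => n; have := xP n; rewrite lt_min => /andP[].
  have [p xp] := w_surj sx; exists p => n; rewrite iterE; apply: NP.
  apply: (@seq_close_on_congr _ _ (seq_shift n x) _ (iterz f ^~ (x n))) => //.
  + exact: weak_orbit_shift.
  + apply: (@seq_close_trans _ (seq_shift n (w p))) => //;
      try exact: weak_orbit_shift.
      exact/seq_close_sym/SP.
    exact/seq_close_shift/seq_close_sym.
  + exact: seq_close_sym.
  + by apply: seq_close_on_sym => k kN; exact/ltW/dP.
Qed.

End Classes.
End PseudoOrbitClasses.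

Theorem theorem4p15 (R : realType) (M : metricType R) (f : homeo M) :
  compact [set: M] -> expansive f ->
  exists (M' : metricType R) (f' : homeo M'),
    [/\ compact [set: M'], expansive f' & shadowing_envelope f f'].
Proof.
move=> cM [c c0 f_exp].
have [m [delta [delta0 halving]]] := expansive_pseudo_orbit cM c0 f_exp.
have alpha0 : 0 < c / 3 by rewrite divr_gt0.
have {}halving : forall x y : int -> M,
    pseudo_orbit f delta x -> pseudo_orbit f delta y -> forall n : int,
    (forall k : int, (`|k| <= m)%N -> mdist (x (n + k)) (y (n + k)) <= c / 3) ->
    mdist (x n) (y n) <= c / 3 / 2.
  by move=> x y xP yP n /(halving x y xP yP n); lra.
have [X [w [w_weak w_inj w_surj [Xw wX]]]] :=
  pseudo_orbit_classes alpha0 delta0 halving.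
have cX := classes_compact alpha0 delta0 halving w_weak w_surj wX cM.
have [|f' [f'_exp f'_env]] :=
    classes_envelope alpha0 delta0 halving w_weak w_inj w_surj Xw wX cM.
  (* Expansivity passes from [c] to the smaller constant [c / 3]. *)
  by move=> u v uv; apply: f_exp => n; apply: le_trans (uv n) _; lra.
by exists X, f'.
Qed.
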